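(* Let $H\in(0,1)$. The following assertions hold. (a) For all $h\in[0,1)$ and $t\in[0,1-h]$, we have $|x^H(t+h)-x^H(t)|\le\omega_H(h)$. (b) The inequality in (a) is sharp in the sense that $$\limsup_{h\downarrow0}\max_{t\in[0,1-h]}\frac{|x^H(t+h)-x^H(t)|}{\omega_H(h)}=1.$$
   Context: Faber--Schauder functions: for $t\in\mathbb R$, $e_{0,0}(t):=(\min\{t,1-t\})^+$ and $e_{m,k}(t):=2^{-m/2}e_{0,0}(2^mt-k)$ for $m\ge 1$, $k\in\mathbb Z$. The Takagi--Landsberg function with Hurst parameter $H$ is $x^H(t):=\sum_{m=0}^\infty 2^{m(1/2-H)}\sum_{k=0}^{2^m-1}e_{m,k}(t)$ for $0\le t\le1$. For $h>0$ let $\nu(h)=\lfloor-\log_2h\rfloor$, where $\lfloor a\rfloor$ is the largest integer not exceeding $a$, and define $$\omega_H(h)=\frac{h\,2^{(\nu(h)-1)(1-H)}}{2^{1-H}-1}+\frac{2^{(1-\nu(h))H}}{3(1-2^{-H})}.$$ By convention $\omega_H(0):=0$. *)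

(* Defs.v *)
From mathcomp Require Import all_boot all_order all_algebra.
From mathcomp Require Import all_classical all_reals all_analysis.

Set Implicit Arguments.
Unset Strict Implicit.
Unset Printing Implicit Defensive.

Import Order.TTheory GRing.Theory Num.Theory.
Import numFieldNormedType.Exports.

Local Open Scope classical_set_scope.
Local Open Scope ring_scope.

Definition e00 {R : realType} (t : R) : R := Num.max (Num.min t (1 - t)) 0.

(* For m = 0 and k = 0 the formula reduces to e00 t, so one clause covers all
   the functions. *)
Definition faber_schauder {R : realType} (m : nat) (k : int) (t : R) : R :=
  2 `^ (- (m%:R / 2)) * e00 (2 ^+ m * t - k%:~R).

(* Only the values at t in [0, 1] are meaningful; elsewhere the sum is 0. *)
Definition takagi_landsberg {R : realType} (H t : R) : R :=
  limn (series (fun m : nat =>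
    2 `^ (m%:R * (2^-1 - H)) * \sum_(k < 2 ^ m) faber_schauder m k%:Z t)).

Definition log2 {R : realType} (h : R) : R := ln h / ln 2.

Definition nu {R : realType} (h : R) : int := Num.floor (- log2 h).

(* The case h = 0 is the convention omega H 0 = 0; negative h are junk. *)
Definition omega {R : realType} (H h : R) : R :=
  if h == 0 then 0 else
    h * 2 `^ (((nu h)%:~R - 1) * (1 - H)) / (2 `^ (1 - H) - 1)
    + 2 `^ ((1 - (nu h)%:~R) * H) / (3 * (1 - 2 `^ (- H))).

Definition is_max {R : realType} (A : set R) (m : R) : Prop :=
  A m /\ ubound A m.

(* Main.v *)
(* On [0, 1] the function is [T t = sum_m a^m d(2^m t)], where [a = 2^-H] lies
   in (1/2, 1) and [d] is the distance to the nearest integer; hence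
   [T t = d t + a * T (2 t)].  Since [d] is 1-Lipschitz and [T] takes values in
   [0, C] with [C = 1 / (3 (1 - a))], using the Lipschitz bound for the terms
   [m < k] and the range of [T] for the rest gives
     [|T s - T t| <= |s - t| ((2a)^k - 1) / (2a - 1) + a^k C],
   which for [k = nu |s - t| - 1] is below [omega].  For [t = 0] and
   [s = 2^-k / 3] this is an equality, because the first [k] terms are linear
   on [0, s] and [T (1/3) = C]; there the ratio is at least [1 - (2a)^-k]. *)

Require Import Defs.
From mathcomp Require Import all_boot all_order all_algebra.
From mathcomp Require Import all_classical all_reals all_analysis.
From mathcomp Require Import ring lra.

Import Order.TTheory GRing.Theory Num.Theory.
Import numFieldNormedType.Exports.

Local Open Scope classical_set_scope.
Local Open Scope ring_scope.

(** * Distance to the nearest integer *)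

Definition dist_int {R : realType} (x : R) : R :=
  Num.min (x - (Num.floor x)%:~R) ((Num.floor x)%:~R + 1 - x).

(** The floor jumps at the right endpoint [n + 1], but both sides are 0 there. *)
Lemma dist_int_itv {R : realType} (n : int) (x : R) :
  n%:~R <= x <= n%:~R + 1 -> dist_int x = Num.min (x - n%:~R) (n%:~R + 1 - x).
Proof.
move=> /andP[nx]; rewrite le_eqVlt => /predU1P[->|xn]; last first.
  by rewrite /dist_int (@floor_def _ x n)// nx intrD1.
rewrite /dist_int (_ : Num.floor _ = n + 1); last first.
  by apply: floor_def; rewrite !intrD1 lexx /= ltrDl.
rewrite intrD1 subrr min_l; last lra.
by rewrite min_r//; lra.
Qed.

Lemma dist_int_ge0 {R : realType} (x : R) : 0 <= dist_int x.
Proof. by have := floor_itv x; rewrite intrD1 /dist_int le_min; lra. Qed.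

Lemma dist_int_le_half {R : realType} (x : R) : dist_int x <= 1 / 2.
Proof. by rewrite /dist_int ge_min; lra. Qed.

Lemma dist_int_le {R : realType} (n : int) (x : R) :
  dist_int x <= `|x - n%:~R|.
Proof.
have := floor_itv x; rewrite /dist_int; set m := Num.floor x => xm.
case: (leP n m) => [|]; [|rewrite -lezD1]; rewrite -(ler_int R).
  move=> nm; rewrite ge_min; apply/orP; left.
  by apply: le_trans (ler_norm _); lra.
move=> mn; rewrite ge_min; apply/orP; right.
by rewrite distrC; apply: le_trans (ler_norm _); move: mn; rewrite intrD1; lra.
Qed.

Lemma dist_int_witness {R : realType} (x : R) :
  exists n : int, dist_int x = `|x - n%:~R|.
Proof.
have := floor_itv x; rewrite /dist_int; set m := Num.floor x.
rewrite intrD1 => xm; case: (leP (x - m%:~R) (m%:~R + 1 - x)) => _.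
  by exists m; rewrite ger0_norm//; lra.
by exists (m + 1); rewrite distrC intrD1 ger0_norm//; lra.
Qed.

(** [dist_int] is the minimum over integers [n] of the 1-Lipschitz functions [|x - n|]: a minimizer
    for [y] is a competitor for [x]. *)
Lemma dist_int_lip {R : realType} (x y : R) :
  `|dist_int x - dist_int y| <= `|x - y|.
Proof.
wlog xy : x y / dist_int y <= dist_int x => [wh|].
  have /orP[/wh//|/wh] := le_total (dist_int y) (dist_int x).
  by rewrite (distrC y) (distrC (dist_int y)).
rewrite ger0_norm ?subr_ge0// lerBlDr.
have [n ->] := dist_int_witness y.
apply: le_trans (dist_int_le n x) _.
by rewrite (_ : x - n%:~R = (x - y) + (y - n%:~R)) ?ler_normD//; ring.
Qed.

Lemma dist_int_id {R : realType} (x : R) : 0 <= x <= 1 / 2 -> dist_int x = x.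
Proof. by move=> x01; rewrite (@dist_int_itv _ 0) ?min_l; lra. Qed.

(** On the values of [dist_int], doubling acts as a tent map, so inductions along [2 ^+ m * t] need
    only track [dist_int t]. *)
Lemma dist_int_double {R : realType} (x : R) :
  dist_int (2 * x) = Num.min (2 * dist_int x) (1 - 2 * dist_int x).
Proof.
have := floor_itv x; rewrite intrD1 {2 3}/dist_int.
set n := Num.floor x => xn.
have n2 : (n * 2)%:~R = 2 * n%:~R :> R by rewrite intrM mulrC.
case: (leP (x - n%:~R) (n%:~R + 1 - x)) => h.
  by rewrite (@dist_int_itv _ (n * 2)) n2; [congr Num.min; ring|lra].
rewrite (@dist_int_itv _ (n * 2 + 1)) intrD1 n2; last lra.
by rewrite minC; congr Num.min; ring.
Qed.

(** The tents have supports with disjoint interiors. In the induction, either the new tent vanishes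
    at [x], or [x] lies in the last unit interval and all earlier ones vanish. *)
Lemma sum_e00 {R : realType} (N : nat) (x : R) :
  0 <= x <= N%:R -> \sum_(k < N) e00 (x - k%:R) = dist_int x.
Proof.
elim: N => [|N IH] xN.
  by move: xN; rewrite mulr0n => xN; rewrite big_ord0 dist_int_id; lra.
rewrite big_ord_recr /=; have [xleN|Nx] := leP x N%:R.
  by rewrite IH /e00 ?[Num.max _ _]max_r ?addr0// ?ge_min; lra.
rewrite big1 => [|k _]; last first.
  have kN : k%:R + 1 <= N%:R :> R by rewrite natr1 ler_nat.
  by rewrite /e00 max_r// ge_min; lra.
move: xN; rewrite -natr1 => xN.
rewrite add0r (@dist_int_itv _ N) /e00 ?[Num.max _ _]max_l -?pmulrn ?le_min;
  [|lra|lra].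
by congr Num.min; ring.
Qed.

(** * The Takagi series, its functional equation and its range *)

(** Summing [dist_int] instead of finitely many tents makes sense for every real [t], so [t] can be
    replaced by [2 * t] freely. *)
Definition takagi {R : realType} (a t : R) : R :=
  limn (series (fun m => a ^+ m * dist_int (2 ^+ m * t))).

(** The exponents [m (1/2 - H)] and [- m / 2] add up to [- m H]. The range of [t] keeps [2 ^+ m * t]
    where the [2 ^ m] tents cover. *)
Lemma takagi_landsbergE {R : realType} (H t : R) : 0 <= t <= 1 ->
  takagi_landsberg H t = takagi (2 `^ (- H)) t.
Proof.
move=> t01; congr (limn (series _)); apply/funext => m.
rewrite -mulr_sumr mulrA; congr (_ * _).
  rewrite -powRD; last by apply/implyP => _; rewrite pnatr_eq0.
  by rewrite -powR_mulrn ?powR_ge0// -powRrM; congr (_ `^ _); lra.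
rewrite -(@sum_e00 _ (2 ^ m)); first by apply: eq_bigr => k _; rewrite -pmulrn.
have : 0 < (2 : R) ^+ m by rewrite exprn_gt0.
by rewrite natrX; set y := 2 ^+ m; nra.
Qed.

Definition takagi_max {R : realType} (a : R) : R := (3 * (1 - a))^-1.

Lemma takagi_cvg {R : realType} (a t : R) : 1 / 2 < a < 1 ->
  cvgn (series (fun m => a ^+ m * dist_int (2 ^+ m * t))).
Proof.
move=> a01; have a_ge0 : 0 <= a by lra.
apply: (@series_le_cvg _ _ (geometric (1 / 2) a)).
- by move=> n; rewrite mulr_ge0 ?dist_int_ge0 ?exprn_ge0.
- by move=> n /=; rewrite mulr_ge0 ?exprn_ge0//; lra.
- by move=> n /=; rewrite mulrC ler_wpM2r ?dist_int_le_half ?exprn_ge0.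
- by apply: is_cvg_geometric_series; rewrite ger0_norm; lra.
Qed.

Lemma partial_takagiS {R : realType} (a t : R) N :
  series (fun m => a ^+ m * dist_int (2 ^+ m * t)) N.+1 =
  dist_int t + a * series (fun m => a ^+ m * dist_int (2 ^+ m * (2 * t))) N.
Proof.
rewrite /series /= big_nat_recl//= expr0 !mul1r mulr_sumr; congr (_ + _).
by apply: eq_bigr => m _; rewrite !exprS !mulrA (mulrC _ 2) -!mulrA.
Qed.

Lemma takagi_step {R : realType} (a t : R) : 1 / 2 < a < 1 ->
  takagi a t = dist_int t + a * takagi a (2 * t).
Proof.
move=> a01; rewrite {1}/takagi; apply/cvg_lim => //; rewrite -cvg_shiftS /=.
under eq_fun do rewrite partial_takagiS.
by apply: cvgD; [exact: cvg_cst|apply: cvgMl_tmp; exact: takagi_cvg].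
Qed.

Lemma takagi_ge0 {R : realType} (a t : R) : 1 / 2 < a < 1 -> 0 <= takagi a t.
Proof.
move=> a01; apply: limr_ge; first exact: takagi_cvg.
apply: nearW => N; rewrite sumr_ge0// => m _.
by rewrite mulr_ge0 ?dist_int_ge0 ?exprn_ge0//; lra.
Qed.

Lemma takagi_max_ge {R : realType} (a : R) : 1 / 2 < a < 1 ->
  1 / 3 <= takagi_max a.
Proof.
by move=> a01; rewrite /takagi_max invfM mul1r ler_peMr// invf_ge1; lra.
Qed.

Lemma takagi_max_step {R : realType} (a : R) : 1 / 2 < a < 1 ->
  takagi_max a = 1 / 3 + a * takagi_max a.
Proof. by move=> a01; rewrite /takagi_max; field; lra. Qed.

(* The correction [min (dist_int t - 1/3) 0] makes the induction go through:
   with [d := dist_int t], it reduces to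
   [d - 1/3 + a * min (dist_int (2 t) - 1/3) 0 <= min (d - 1/3) 0],
   which for [d > 1/3] is [(1 - 2 a) * (d - 1/3) <= 0]. *)
Lemma partial_takagi_le {R : realType} (a t : R) N : 1 / 2 < a < 1 ->
  series (fun m => a ^+ m * dist_int (2 ^+ m * t)) N <=
  takagi_max a + Num.min (dist_int t - 1 / 3) 0.
Proof.
move=> a01; elim: N t => [|N IH] t.
  have := takagi_max_ge _ a01; have := dist_int_ge0 t.
  by rewrite /series /= big_geq//; case: (leP (dist_int t - 1 / 3) 0); lra.
rewrite partial_takagiS; have a0 : 0 < a by lra.
have := IH (2 * t); rewrite -(ler_pM2l a0).
move: (series _ _) => S; rewrite dist_int_double mulrDr.
move: (takagi_max_step _ a01) (dist_int_ge0 t) (dist_int_le_half t).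
move: (dist_int t) => d Cfix d0 d1.
set g := Num.min (Num.min _ _ - _) 0 => HS.
suff : a * g <= Num.min (d - 1 / 3) 0 - (d - 1 / 3) by lra.
have g0 : g <= 0 by rewrite ge_min lexx orbT.
have g1 : g <= 1 - 2 * d - 1 / 3.
  by rewrite ge_min lerD2r ge_min lexx orbT.
by clear - a01 a0 d0 d1 g0 g1; case: (leP (d - 1 / 3) 0) => hd; nra.
Qed.

Lemma takagi_le {R : realType} (a t : R) : 1 / 2 < a < 1 ->
  takagi a t <= takagi_max a.
Proof.
move=> a01; apply: limr_le; first exact: takagi_cvg.
apply: nearW => N; apply: le_trans (partial_takagi_le _ _ N a01) _.
by rewrite gerDl ge_min lexx orbT.
Qed.

(** * Modulus of continuity and extremal points *)

(** Each use of [takagi_step] doubles the distance and multiplies the weight by [a], so the quotient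
    is the geometric sum of [(2 * a) ^+ m] for [m < M]. For [M = 0] only the range of [takagi] is
    used. *)
Lemma takagi_modulus {R : realType} (a s t : R) M : 1 / 2 < a < 1 ->
  `|takagi a s - takagi a t| <=
  `|s - t| * (((2 * a) ^+ M - 1) / (2 * a - 1)) + a ^+ M * takagi_max a.
Proof.
move=> a01; elim: M s t => [|M IH] s t.
  rewrite !expr0 subrr mul0r mulr0 add0r mul1r ler_norml.
  have := takagi_ge0 _ s a01; have := takagi_ge0 _ t a01.
  by have := takagi_le _ s a01; have := takagi_le _ t a01; lra.
rewrite (takagi_step _ s)// (takagi_step _ t)// opprD addrACA -mulrBr.
apply: le_trans (ler_normD _ _) _.
rewrite normrM (@ger0_norm _ a); last lra.
have h1 := dist_int_lip s t; have := IH (2 * s) (2 * t).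
rewrite -mulrBr normrM ger0_norm// => h2.
have a0 : 0 <= a by lra.
apply: le_trans (lerD h1 (ler_wpM2l a0 h2)) _.
by rewrite le_eqVlt; apply/orP; left; apply/eqP; rewrite !exprS; field; lra.
Qed.

(** Continuity serves to show that the maximum over [t] in assertion (b) is attained. *)
Lemma takagi_continuous {R : realType} (a : R) : 1 / 2 < a < 1 ->
  continuous (takagi a).
Proof.
move=> a01 t; apply/cvgrPdist_le => /= e e0.
have C0 : 0 < takagi_max a by have := takagi_max_ge _ a01; lra.
have : a ^+ M @[M --> \oo] --> 0 by apply: cvg_expr; rewrite ger0_norm; lra.
(* This choice of [M] makes the range term at most [e / 2]; the Lipschitz term is then handled with
   [M] fixed. *)
move=> /cvgrPdist_le /(_ (e / 2 / takagi_max a)) /(_ _)[].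
  by rewrite !divr_gt0.
move=> M _ /(_ M (leqnn M)); rewrite /= sub0r normrN ger0_norm; last first.
  by rewrite exprn_ge0; lra.
rewrite ler_pdivlMr// => hM.
set K := ((2 * a) ^+ M - 1) / (2 * a - 1).
have K0 : 0 <= K by rewrite divr_ge0 ?subr_ge0 ?exprn_ege1//; lra.
(* [K] vanishes when [M = 0], hence the division by [K + 1] below. *)
have K1 : 0 < K + 1 by lra.
near=> s; apply: le_trans (takagi_modulus _ t s M a01) _; rewrite -/K.
have : `|t - s| <= e / 2 / (K + 1).
  near: s; apply: cvgr_dist_le; first exact: cvg_id.
  by rewrite !divr_gt0.
rewrite ler_pdivlMr//; have := normr_ge0 (t - s); nra.
Unshelve. all: by end_near. Qed.

(** [1/3] is a fixed point of the tent map, so every term of the series is [a ^+ m / 3]. *)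
Lemma takagi_third {R : realType} (a : R) : 1 / 2 < a < 1 ->
  takagi a 3^-1 = takagi_max a.
Proof.
move=> a01; have h m : dist_int (2 ^+ m * 3^-1) = 3^-1 :> R.
  elim: m => [|m IH]; first by rewrite expr0 mul1r dist_int_id; lra.
  by rewrite exprS -mulrA dist_int_double IH min_r; lra.
rewrite /takagi; under eq_fun do rewrite h mulrC.
rewrite (cvg_lim _ (cvg_geometric_series _))// ?ger0_norm; try lra.
by rewrite /takagi_max; field; lra.
Qed.

Lemma takagi0 {R : realType} (a : R) : 1 / 2 < a < 1 -> takagi a 0 = 0.
Proof.
move=> a01; have := takagi_step _ 0 a01.
by rewrite mulr0 dist_int_id; [nra|lra].
Qed.

(** Equality in [takagi_modulus] at [t = 0]: the point for [k.+1] is below [1/2], where [dist_int]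
    is the identity, and doubling sends it to the point for [k]. *)
Lemma takagi_extremal {R : realType} (a : R) k : 1 / 2 < a < 1 ->
  takagi a ((2 ^+ k)^-1 / 3) =
  (2 ^+ k)^-1 / 3 * (((2 * a) ^+ k - 1) / (2 * a - 1)) + a ^+ k * takagi_max a.
Proof.
move=> a01; elim: k => [|k IH].
  by rewrite !expr0 invr1 subrr mul0r mulr0 add0r !mul1r takagi_third.
have p0 : 0 < (2 : R) ^+ k by rewrite exprn_gt0.
have p1 : (2 ^+ k)^-1 <= 1 :> R by rewrite invf_le1// exprn_ege1//; lra.
have q0 : 0 < (2 ^+ k)^-1 :> R by rewrite invr_gt0.
rewrite takagi_step// dist_int_id; last by rewrite exprS invfM; lra.
rewrite (_ : 2 * _ = (2 ^+ k)^-1 / 3); last by rewrite exprS; field; lra.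
by rewrite IH !exprS; field; lra.
Qed.

(** * Powers of two, [nu] and [omega] *)

Lemma ltr_powR2 {R : realType} (x y : R) : ((2 : R) `^ x < 2 `^ y) = (x < y).
Proof. by rewrite /powR pnatr_eq0 /= ltr_expR ltr_pM2r// ln_gt0 ?ltr1n. Qed.

Lemma powR_neg_itv {R : realType} (H : R) : 0 < H < 1 ->
  1 / 2 < (2 : R) `^ (- H) < 1.
Proof.
move=> hH; apply/andP; split.
  by rewrite div1r -powR_inv1// ltr_powR2; lra.
by rewrite -[ltRHS](powRr0 (2 : R)) ltr_powR2; lra.
Qed.

Lemma powR_double {R : realType} (H : R) :
  (2 : R) `^ (1 - H) = 2 * 2 `^ (- H).
Proof. by rewrite powRD ?powRr1// pnatr_eq0 implybT. Qed.

Lemma nu_ge0 {R : realType} (h : R) : 0 < h < 1 -> 0 <= nu h.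
Proof.
move=> h01; rewrite /nu floor_ge_int /log2 oppr_ge0.
rewrite pmulr_lle0 ?invr_gt0 ?ln_gt0//; last lra.
by rewrite -ln1 ler_ln ?posrE//; lra.
Qed.

(** The reciprocal [3 * 2 ^+ k] lies between [2 ^+ k.+1] and [2 ^+ k.+2]. *)
Lemma nu_third {R : realType} k : nu ((2 ^+ k)^-1 / 3 : R) = k.+1.
Proof.
have p0 : 0 < (2 : R) ^+ k by rewrite exprn_gt0.
have l2 : 0 < ln (2 : R) by rewrite ln_gt0//; lra.
rewrite /nu /log2; apply: floor_def.
rewrite -mulNr -lnV ?posrE ?divr_gt0 ?invr_gt0// invfM !invrK.
rewrite ler_pdivlMr// ltr_pdivrMr// -[Posz _ + 1]/(Posz (k.+1 + 1)) addn1.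
rewrite -!pmulrn !mulr_natl -!lnXn//.
rewrite ler_ln ?ltr_ln ?posrE ?exprn_gt0 ?mulr_gt0//.
by rewrite !exprS; lra.
Qed.

(** The exponent [nu h - 1] is the natural number [k]. The result is the bound of [takagi_modulus]
    for [M = k], except that [(2 * a) ^+ k] replaces [(2 * a) ^+ k - 1]. *)
Lemma omegaE {R : realType} (H h : R) k : h != 0 -> nu h = k.+1 ->
  omega H h =
    h * (2 * 2 `^ (- H)) ^+ k / (2 * 2 `^ (- H) - 1) +
    (2 `^ (- H)) ^+ k * takagi_max (2 `^ (- H)).
Proof.
move=> h0 nuh; rewrite /omega (negbTE h0) nuh -pmulrn -powR_double.
rewrite -!(@powR_mulrn _ _ k) ?powR_ge0// -!powRrM -natr1 /takagi_max.
by congr (_ * 2 `^ _ / _ + 2 `^ _ / _); ring.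
Qed.

(** Here [nu h - 1 = -1] is no number of terms, but the second summand of [omega] is [2 ^ H] times
    [takagi_max], which already suffices. *)
Lemma omega_ge_max {R : realType} (H h : R) : 0 < H < 1 -> 0 < h -> nu h = 0 ->
  takagi_max (2 `^ (- H)) <= omega H h.
Proof.
move=> hH h0 nuh; have a01 := powR_neg_itv H hH.
rewrite /omega gt_eqF// nuh.
have b2 := powR_double H; rewrite subr0 mul1r.
apply: (@le_trans _ _ (2 `^ H * takagi_max (2 `^ (- H)))).
  rewrite ler_peMl//; first by have := takagi_max_ge _ a01; lra.
  by rewrite -[leLHS](powRr0 (2 : R)) ler_powR; lra.
by rewrite lerDr divr_ge0 ?mulr_ge0 ?powR_ge0; lra.
Qed.

Lemma omega_gt0 {R : realType} (H h : R) : 0 < H < 1 -> 0 < h < 1 ->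
  0 < omega H h.
Proof.
move=> hH h01; have a01 := powR_neg_itv H hH.
have b2 := powR_double H.
rewrite /omega gt_eqF; last lra.
by rewrite addr_gt0// divr_gt0 ?mulr_gt0 ?powR_gt0//; lra.
Qed.

(** * The bound by [omega] and its asymptotic sharpness *)

Lemma takagi_omega {R : realType} (H s t : R) : 0 < H < 1 ->
  0 < `|s - t| < 1 ->
  `|takagi (2 `^ (- H)) s - takagi (2 `^ (- H)) t| <= omega H `|s - t|.
Proof.
move=> hH st; have a01 := powR_neg_itv H hH.
case nuh : (nu `|s - t|) (nu_ge0 _ st) => [[|k]|//] _.
  apply: le_trans (omega_ge_max _ _ hH _ nuh); last lra.
  by have := takagi_modulus _ s t 0 a01; rewrite !expr0 subrr mul0r mulr0; lra.
rewrite (omegaE _ _ k)//; last by rewrite gt_eqF; lra.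
apply: le_trans (takagi_modulus _ s t k a01) _.
rewrite lerD2r -mulrA ler_wpM2l// ler_wpM2r ?invr_ge0; lra.
Qed.

(** With [B = (2 * a) ^+ k], [W = h * B / (2 * a - 1)] and [D = a ^+ k * takagi_max a], the ratio is
    [(W - W / B + D) / (W + D)], and [D >= 0]. *)
Lemma takagi_omega_sharp {R : realType} (H : R) k (h := (2 ^+ k)^-1 / 3) :
  0 < H < 1 ->
  1 - ((2 * 2 `^ (- H)) ^+ k)^-1 <=
  `|takagi (2 `^ (- H)) (0 + h) - takagi (2 `^ (- H)) 0| / omega H h.
Proof.
move=> hH; have a01 := powR_neg_itv H hH.
have h0 : 0 < h by rewrite divr_gt0// invr_gt0 exprn_gt0.
rewrite add0r takagi0// subr0 ger0_norm ?takagi_ge0// takagi_extremal//.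
rewrite (omegaE _ _ k) ?nu_third//; last by rewrite gt_eqF.
rewrite -/h; set a := 2 `^ (- H) in a01 *.
have B0 : 0 < (2 * a) ^+ k by rewrite exprn_gt0; lra.
have C0 : 0 <= a ^+ k * takagi_max a.
  rewrite mulr_ge0 ?exprn_ge0//; first lra.
  by have := takagi_max_ge _ a01; lra.
move: (a ^+ k * _) C0 => D D0.
set B := (2 * a) ^+ k in B0 *.
have b0 : 0 < (2 * a - 1)^-1 by rewrite invr_gt0; lra.
move: (2 * a - 1)^-1 b0 => c c0.
have W0 : 0 < h * B * c by rewrite !mulr_gt0.
rewrite ler_pdivlMr; last lra.
have Bi0 : 0 <= B^-1 by rewrite invr_ge0 ltW.
have -> : h * ((B - 1) * c) = h * B * c - B^-1 * (h * B * c).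
  by field; lra.
by have := mulr_ge0 Bi0 D0; lra.
Qed.

(** * Existence of the maxima and the upper limit *)

Lemma max_exists {R : realType} (f : R -> R) (a b : R) : a <= b ->
  continuous f -> exists M, is_max [set f t | t in `[a, b]] M.
Proof.
move=> ab cf; have [|c cab cmax] := @EVT_max _ f a b ab.
  exact: continuous_subspaceT.
exists (f c); split; first by exists c.
by move=> _ [t tab <-]; exact: cmax.
Qed.

Theorem theorem2p7 (R : realType) (H : R) (hH : 0 < H < 1) :
  (forall h t : R, 0 <= h < 1 -> 0 <= t <= 1 - h ->
    `|takagi_landsberg H (t + h) - takagi_landsberg H t| <= omega H h) /\
  (exists M : R -> R,
    (forall h : R, 0 < h < 1 ->
      is_max [set `|takagi_landsberg H (t + h) - takagi_landsberg H t|
                  / omega H h | t in `[0, 1 - h]] (M h)) /\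
    limf_esup (fun h : R => (M h)%:E) (0 : R)^'+ = 1%:E).
Proof.
have a01 := powR_neg_itv H hH; set a := 2 `^ (- H) in a01.
have xE h t : 0 < h < 1 -> 0 <= t <= 1 - h ->
    takagi_landsberg H (t + h) - takagi_landsberg H t =
    takagi a (t + h) - takagi a t.
  by move=> h01 th; rewrite !takagi_landsbergE//; lra.
have bound h t : 0 < h < 1 ->
    `|takagi a (t + h) - takagi a t| <= omega H h.
  move=> h01; have ht : `|t + h - t| = h by rewrite addrC addKr ger0_norm; lra.
  by rewrite -{2}ht; apply: takagi_omega => //; rewrite ht.
split=> [h t|].
  rewrite le_eqVlt => /andP[/predU1P[<- _ _|h0 h1 th]].
    by rewrite addr0 subrr normr0 /omega eqxx.
  by rewrite xE ?bound ?h0.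
(* Outside [0 < h < 1] the value of [M] is an arbitrary 0; this does not affect the limit at [0]
   from the right. *)
have /choice[M maxM] (h : R) : exists m : R, 0 < h < 1 ->
    is_max [set `|takagi_landsberg H (t + h) - takagi_landsberg H t|
                / omega H h | t in `[0, 1 - h]] m.
  have [h01|_] := boolP (0 < h < 1); last by exists 0.
  have [||m mM] := @max_exists _
      (fun t => `|takagi a (t + h) - takagi a t| / omega H h) 0 (1 - h).
  - lra.
  - move=> t; apply: cvgMr_tmp; apply: cvg_norm; apply: cvgB.
      apply: (@cvg_comp _ _ _ (fun t => t + h) (takagi a)); last first.
        exact: takagi_continuous.
      by apply: cvgD; [exact: cvg_id|exact: cvg_cst].
    exact: takagi_continuous.
  exists m => _; congr is_max : mM.
  by apply: eq_imagel => t /=; rewrite in_itv /= => th; rewrite xE.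
exists M; split=> [//|]; apply/eqP; rewrite eq_le; apply/andP; split.
  (* The upper limit is an infimum of suprema over neighbourhoods; on []0, 1[] the bound already
     gives a supremum at most 1. *)
  apply: ereal_inf_le.
  exists (ereal_sup [set (M h)%:E | h in `]0, (1 : R)[%classic]).
    exists `]0, (1 : R)[%classic => //; near=> h; rewrite /= in_itv /=.
    by apply/andP; split; near: h; [exact: nbhs_right_gt|exact: nbhs_right_lt].
  apply: ge_ereal_sup => _ [h /= + <-]; rewrite in_itv /= => h01.
  have [[t /=]] := maxM h h01; rewrite in_itv /= => th <- _.
  by rewrite lee_fin ler_pdivrMr ?omega_gt0// mul1r xE// bound.
(* Conversely, every neighbourhood [V] contains the points [2^-k / 3] for large [k], where the ratio
   at [t = 0] is at least [1 - (2 * a)^-k >= 1 - e]. *)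
apply: le_ereal_inf_tmp => _ [V V0 <-].
apply/lee_addgt0Pr => e e0.
have hV : `|2^-1 : R| < 1 by rewrite ger0_norm; lra.
have bV : `|(2 * a)^-1| < 1 by rewrite ger0_norm ?invr_ge0 ?invf_lt1; lra.
have hk : (2^-1) ^+ k / 3 @[k --> \oo] --> (0 : R).
  rewrite -[X in _ --> X](mul0r (3^-1 : R)).
  by apply: cvgMr_tmp; exact: cvg_expr.
have hb : ((2 * a)^-1) ^+ k @[k --> \oo] --> (0 : R) by exact: cvg_expr.
near \oo => k.
have h_lt1 : (2^-1) ^+ k / 3 < 1 :> R by near: k; apply: (cvgr_lt _ hk).
(* A right neighbourhood of 0 is a neighbourhood restricted to positive points, hence the
   premise. *)
have Vh : 0 < (2^-1) ^+ k / 3 :> R -> V ((2^-1) ^+ k / 3).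
  by near: k; exact: (hk _ V0).
have bk : ((2 * a)^-1) ^+ k <= e.
  by near: k; apply: (cvgr_le _ hb).
set h := (2^-1) ^+ k / 3 in h_lt1 Vh.
have h_gt0 : 0 < h by rewrite divr_gt0 ?exprn_gt0 ?invr_gt0.
have Mh : [set (M x)%:E | x in V] (M h)%:E by exists h => //; exact: Vh.
have le_sup := ereal_sup_ubound Mh.
apply: le_trans (leeD2r _ le_sup); rewrite -EFinD lee_fin -lerBlDr.
have h01 : 0 < h < 1 by rewrite h_gt0.
have [_ ub] := maxM h h01.
apply: le_trans (ub _ _); last first.
  by exists 0 => //=; rewrite in_itv /= lexx; lra.
rewrite xE//; last lra.
apply: le_trans (_ : 1 - ((2 * a)^-1) ^+ k <= _); first lra.
by rewrite /h !exprVn; exact: takagi_omega_sharp.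
Unshelve. all: by end_near. Qed.
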